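(* Let $\mathbb{X}$ be a two-dimensional real Banach space and let $\epsilon\in[0,1)$. Then for any $x \in S_{\mathbb{X}}$, $A(x, \epsilon) = D \cup (-D)$, where $D$ is a connected subset of $S_{\mathbb{X}}$.
   Context: $S_{\mathbb{X}}$ is the unit sphere of $\mathbb{X}$. For $\epsilon\in[0,1)$, approximate isosceles orthogonality $x\perp_I^{\epsilon} y$ means $\left|\|x+y\|^2-\|x-y\|^2\right|\le 4\epsilon\|x\|\|y\|$. For $x\in S_{\mathbb{X}}$, $A(x, \epsilon) = \{ y\in S_{\mathbb{X}} : x\perp_I^{\epsilon} y \}$. *)

(* Defs.v *)
From HB Require Import structures.
From mathcomp Require Import all_boot all_order all_algebra.
From mathcomp Require Import all_classical all_reals all_analysis.

Set Implicit Arguments.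
Unset Strict Implicit.
Unset Printing Implicit Defensive.

Import Order.TTheory GRing.Theory Num.Theory.
Import numFieldNormedType.Exports.

Local Open Scope classical_set_scope.
Local Open Scope ring_scope.

Definition unit_sphere (R : realType) (X : normedModType R) : set X :=
  [set x | `|x| = 1].
Arguments unit_sphere {R} X.

Definition approx_isosceles_orth (R : realType) (X : normedModType R)
    (eps : R) (x y : X) : Prop :=
  `| `|x + y| ^+ 2 - `|x - y| ^+ 2 | <= 4 * eps * `|x| * `|y|.

Definition isosceles_orth_set (R : realType) (X : normedModType R)
    (x : X) (eps : R) : set X :=
  [set y | unit_sphere X y /\ approx_isosceles_orth eps x y].

(* Main.v *)
Require Import Defs.
From HB Require Import structures.
From mathcomp Require Import all_boot all_order all_algebra.
From mathcomp Require Import all_classical all_reals all_analysis.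
From mathcomp Require Import ring lra.

(** Every point of the sphere off the line through [x] is, up to sign, on the
    half-circle [t |-> (t x + z) / |t x + z|], where [x, z] is a basis.  By the
    monotonicity lemma for normed planes, [|x + y|] is nondecreasing and
    [|x - y|] is nonincreasing in [t] along that half-circle, so
    [|x + y|^2 - |x - y|^2] is nondecreasing and the parameters at which its
    absolute value is at most [4 eps] form an interval; [D] is the image of
    this interval.  The points [x] and [- x] are excluded because [eps < 1]. *)

Set Implicit Arguments.
Unset Strict Implicit.
Unset Printing Implicit Defensive.

Import Order.TTheory GRing.Theory Num.Theory.
Import numFieldNormedType.Exports.

Local Open Scope classical_set_scope.
Local Open Scope ring_scope.

(** In coordinates [z] is [x = (p, q)] turned by a right angle, [(- q, p)], so the determinant of
    the pair is [p ^+ 2 + q ^+ 2], which is nonzero. *)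
Lemma plane_complement (R : realFieldType) (X : lmodType R)
    (dimX : Vector.axiom 2 X) (x : X) : x != 0 ->
  exists z : X, (forall y, exists a b, y = a *: x + b *: z) /\
    (forall t, t *: x + z != 0).
Proof.
case: dimX => f lf [g fK gK] x0.
have fD u v : f (u + v) = f u + f v by have := lf 1 u v; rewrite !scale1r.
have f0 : f 0 = 0 by have := fD 0 0; rewrite addr0 => /eqP; rewrite -subr_eq subrr => /eqP.
have fZ a u : f (a *: u) = a *: f u by have := lf a u 0; rewrite f0 !addr0.
pose p := f x 0 0; pose q := f x 0 1.
have N0 : p ^+ 2 + q ^+ 2 != 0.
  apply: contra x0; rewrite paddr_eq0 ?sqr_ge0// !sqrf_eq0 => /andP[/eqP p0 /eqP q0].
  apply/eqP/(can_inj fK); rewrite f0; apply/rowP => i; rewrite mxE.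
  by case: i => -[|[|//]] hi; [rewrite -[RHS]p0 | rewrite -[RHS]q0];
    congr (f x _ _); apply/val_inj.
pose w : 'rV[R]_2 := \row_i (if i == 0 then - q else p).
exists (g w); split=> [y|t].
  pose y0 := f y 0 0; pose y1 := f y 0 1.
  (* Cramer's rule for the columns [(p, q)] and [(- q, p)]. *)
  exists ((y0 * p + y1 * q) / (p ^+ 2 + q ^+ 2)).
  exists ((y1 * p - y0 * q) / (p ^+ 2 + q ^+ 2)).
  apply: (can_inj fK); rewrite fD !fZ gK; apply/rowP => i; rewrite !mxE.
  case: i => -[|[|//]] hi /=.
    rewrite (_ : Ordinal hi = 0); last exact/val_inj.
    by rewrite -/p -/y0; field.
  rewrite (_ : Ordinal hi = 1); last exact/val_inj.
  by rewrite -/q -/y1; field.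
apply: contra N0 => /eqP /(congr1 f); rewrite fD fZ gK f0 => E.
have E0 : t * p - q = 0 by have /rowP/(_ 0) := E; rewrite !mxE.
have E1 : t * q + p = 0 by have /rowP/(_ 1) := E; rewrite !mxE.
(* This combination eliminates [t] and leaves [p ^+ 2 + q ^+ 2]. *)
apply/eqP; transitivity (p * (t * q + p) - q * (t * p - q)); first by ring.
by rewrite E0 E1 !mulr0 subrr.
Qed.

(* The diagonals [0, v] and [x, u] of the quadrilateral 0, x, v, u meet at
   [p = v / (a + b)]; the triangle inequality through [p] does the rest. *)
Lemma sphere_dist_monotone (R : realFieldType) (X : normedModType R)
    (x u v : X) (a b : R) : `|x| = 1 -> `|u| = 1 -> `|v| = 1 ->
  0 <= a -> 0 <= b -> v = a *: x + b *: u -> `|x - v| <= `|x - u|.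
Proof.
move=> nx nu nv a0 b0 vE.
(* This places [p] on the segment from 0 to [v], so that [|p|] and [|p - v|] add up to 1. *)
have ab1 : 1 <= a + b.
  by rewrite -nv vE (le_trans (ler_normD _ _))// !normrZ nx nu !mulr1 !ger0_norm.
have ab0 : 0 < a + b by lra.
have abN0 : a + b != 0 by rewrite gt_eqF.
pose l := a / (a + b); pose m := b / (a + b); pose p := l *: x + m *: u.
have l0 : 0 <= l by rewrite divr_ge0// ltW.
have m0 : 0 <= m by rewrite divr_ge0// ltW.
have lm : l + m = 1 by rewrite /l /m; field.
have pE : p = (a + b)^-1 *: v.
  by rewrite vE scalerDr !scalerA /p /l /m ![_ / _]mulrC.
have k0 : 0 <= (a + b)^-1 by rewrite invr_ge0 ltW.
have k1 : (a + b)^-1 <= 1 by rewrite invf_le1.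
have np : `|p| = (a + b)^-1 by rewrite pE normrZ nv mulr1 ger0_norm.
have npv : `|p - v| = 1 - (a + b)^-1.
  rewrite pE -[X in _ - X]scale1r -scalerBl normrZ nv mulr1 distrC ger0_norm//.
  by rewrite subr_ge0.
have nxp : `|x - p| = m * `|x - u|.
  rewrite (_ : x - p = m *: (x - u)) ?normrZ ?ger0_norm//.
  by rewrite /p opprD addrA -[X in X - _ - _]scale1r -scalerBl -lm [l + m]addrC
    addrK scalerBr.
have npu : `|p - u| = l * `|x - u|.
  rewrite (_ : p - u = l *: (x - u)) ?normrZ ?ger0_norm//.
  rewrite /p -addrA -[X in _ + (_ - X)]scale1r -scalerBl scalerBr -scaleNr.
  by congr (_ + _ *: _); rewrite -lm; ring.
have h1 : `|x - v| <= `|x - p| + `|p - v| by rewrite -(subrKA p) ler_normD.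
have h2 : 1 <= `|p| + `|p - u| by rewrite -nu distrC -[X in `|X| <= _](subrKC p) ler_normD.
have h3 : `|x - u| = m * `|x - u| + l * `|x - u| by rewrite -mulrDl [m + l]addrC lm mul1r.
lra.
Qed.

(** The half-circle is open: [- x] and [x] are its limits as [t] tends to minus and plus
    infinity. *)
Definition half_circle (R : realType) (X : normedModType R) (x z : X) (t : R) : X :=
  `|t *: x + z|^-1 *: (t *: x + z).

Section HalfCircle.
Variables (R : realType) (X : normedModType R) (x z : X).
Hypotheses (nx : `|x| = 1) (xz : forall t : R, t *: x + z != 0).

Local Notation c := (half_circle x z).

Lemma norm_half_circle t : `|c t| = 1.
Proof. by rewrite normrZ normfV normr_id mulVf// normr_eq0. Qed.

Lemma continuous_half_circle : continuous c.
Proof.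
move=> t.
have h : (fun t => t *: x + z) @ t --> t *: x + z.
  by apply: cvgD; [apply: cvgZr_tmp; exact: cvg_id | exact: cvg_cst].
by apply: cvgZ => //; apply: cvgV; [rewrite normr_eq0|exact: cvg_norm].
Qed.

(** Normalise [t x + z = (t - s) x + (s x + z)]. *)
Lemma half_circle_cone s t : s <= t ->
  exists a b, [/\ 0 <= a, 0 <= b & c t = a *: x + b *: c s].
Proof.
move=> st; exists ((t - s) / `|t *: x + z|), (`|s *: x + z| / `|t *: x + z|).
split; [by rewrite divr_ge0// subr_ge0|by rewrite divr_ge0|].
rewrite /half_circle scalerA mulrAC mulfV ?normr_eq0// mul1r [_ / _]mulrC.
by rewrite -scalerA -scalerDr addrA -scalerDl subrK.
Qed.

(** The same identity read backwards, [s x + z = (t - s) (- x) + (t x + z)]. *)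
Lemma half_circle_cone_opp s t : s <= t ->
  exists a b, [/\ 0 <= a, 0 <= b & c s = a *: - x + b *: c t].
Proof.
move=> st; exists ((t - s) / `|s *: x + z|), (`|t *: x + z| / `|s *: x + z|).
split; [by rewrite divr_ge0// subr_ge0|by rewrite divr_ge0|].
rewrite /half_circle scalerA mulrAC mulfV ?normr_eq0// mul1r [_ / _]mulrC.
rewrite -scalerA -scalerDr addrA scalerN -scaleNr -scalerDl; congr (_ *: (_ *: _ + _)).
by ring.
Qed.

Lemma half_circle_isosceles_homo :
  {homo (fun t => `|x + c t| ^+ 2 - `|x - c t| ^+ 2) : s t / s <= t}.
Proof.
move=> s t st; apply: lerB; rewrite lerXn2r ?nnegrE//.
  (* The sum [|x + c t|] is the distance from [- x] to [c t], so monotonicity is applied at [- x]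
     here and at [x] for the difference. *)
  have [a [b [a0 b0 E]]] := half_circle_cone_opp st.
  have := sphere_dist_monotone _ (norm_half_circle t) (norm_half_circle s) a0 b0 E.
  by rewrite -!opprD !normrN; exact.
have [a [b [a0 b0 E]]] := half_circle_cone st.
exact: sphere_dist_monotone nx (norm_half_circle s) (norm_half_circle t) a0 b0 E.
Qed.

(** Factoring out [b] leaves the vector with parameter [a / b]; the norm condition forces [b] to be
    the normalising factor. *)
Lemma half_circleE (a b : R) : 0 < b -> `|a *: x + b *: z| = 1 ->
  a *: x + b *: z = c (a / b).
Proof.
move=> b0 n1.
have E : a *: x + b *: z = b *: ((a / b) *: x + z).
  by rewrite scalerDr scalerA mulrCA mulfV ?gt_eqF// mulr1.
move: n1; rewrite E normrZ gtr0_norm// => n1; congr (_ *: _).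
by rewrite -[LHS](mulfK (_ : `|(a / b) *: x + z| != 0)) ?normr_eq0// n1 mul1r.
Qed.

End HalfCircle.

Lemma isosceles_orth_setN (R : realType) (X : normedModType R) (x : X) (eps : R) y :
  isosceles_orth_set x eps y -> isosceles_orth_set x eps (- y).
Proof.
case=> ny oy; split; first by rewrite /unit_sphere/= normrN.
by move: oy; rewrite /approx_isosceles_orth opprK normrN distrC.
Qed.

Theorem theorem2p20 (R : realType) (X : completeNormedModType R)
    (dimX : Vector.axiom 2 X) (eps : R) (eps_ge0 : 0 <= eps) (eps_lt1 : eps < 1)
    (x : X) (hx : unit_sphere X x) :
  exists D : set X,
    [/\ D `<=` unit_sphere X, connected D
      & isosceles_orth_set x eps = D `|` [set - z | z in D]].
Proof.
have nx : `|x| = 1 := hx.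
have [|z [gen xz]] := plane_complement dimX (x := x).
  by rewrite -normr_eq0 nx oner_neq0.
pose c := half_circle x z.
pose E := [set t | isosceles_orth_set x eps (c t)].
have arcP a b : 0 < b -> isosceles_orth_set x eps (a *: x + b *: z) ->
    (c @` E) (a *: x + b *: z).
  by move=> b0 oy; have Ey := half_circleE xz b0 oy.1;
    exists (a / b); [rewrite /E/= /c -Ey|rewrite Ey].
exists (c @` E); split.
- by move=> _ [t _ <-]; exact: norm_half_circle.
- apply: connected_continuous_connected; last first.
    by apply: continuous_subspaceT; exact: continuous_half_circle.
  (* [E] is an interval: for [r] between [s] and [t], monotonicity carries the lower bound over from
     [s] and the upper bound from [t]. *)
  apply/connected_intervalP => s t [_ os] [_ ot] r /andP[sr rt].
  split; first exact: norm_half_circle.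
  move: os ot; rewrite /approx_isosceles_orth !(norm_half_circle xz) !ler_norml.
  move=> /andP[os _] /andP[_ ot].
  by rewrite (le_trans os (half_circle_isosceles_homo nx xz sr))
    (le_trans (half_circle_isosceles_homo nx xz rt) ot).
- apply/seteqP; split=> [y oy|y [[t Et <-]//|[_ [t Et <-] <-]]]; last first.
    exact: isosceles_orth_setN.
  have [a [b yE]] := gen y; rewrite yE in oy *.
  (* The sign of [b] tells whether [- y] or [y] lies on the half-circle, or [y] is on the line
     through [x]. *)
  case: (ltgtP b 0) => b0.
  + right; exists (- (a *: x + b *: z)); last exact: opprK.
    have := isosceles_orth_setN oy.
    by rewrite opprD -!scaleNr; apply: arcP; rewrite oppr_gt0.
  + by left; exact: arcP.
  (* Here [y = a x] with [|a| = 1], and the difference of squares is [4 a], of absolute value 4,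
     which exceeds [4 eps]. *)
  + case: oy; rewrite b0 scale0r addr0 /unit_sphere/= normrZ nx mulr1 => na.
    rewrite /approx_isosceles_orth.
    rewrite (_ : x + a *: x = (1 + a) *: x); last by rewrite scalerDl scale1r.
    rewrite (_ : x - a *: x = (1 - a) *: x); last by rewrite scalerBl scale1r.
    rewrite !normrZ na nx !mulr1 !real_normK ?num_real//.
    rewrite (_ : _ - _ = 4 * a); last by ring.
    rewrite normrM na normr_nat; lra.
Qed.
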